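(* Let $\mathcal{P}=(\mathcal{PV},\mathcal{L},\ell_0,\mathcal{T})$ be an integer program, let ${\mathcal{RB}_{\text{glo}}}:\mathcal{T}\to\mathcal{B}$ be a global runtime bound and ${\mathcal{SB}}:\mathcal{T}\times\mathcal{PV}\to\mathcal{B}$ a size bound for $\mathcal{P}$. Let $\emptyset\neq\mathcal{T}'_>\subseteq\mathcal{T}'\subseteq\mathcal{T}$ be such that $\mathcal{T}'$ contains no initial transitions, and let ${\mathcal{RB}_{\text{loc}}}:\mathcal{E}_{\mathcal{T}'}\to\mathcal{B}$ be a local runtime bound for $\mathcal{T}'_>$ w.r.t. $\mathcal{T}'$. Define ${\mathcal{RB}'_{\text{glo}}}:\mathcal{T}\to\mathcal{B}$ by ${\mathcal{RB}'_{\text{glo}}}(t)={\mathcal{RB}_{\text{glo}}}(t)$ if $t\in\mathcal{T}\setminus\mathcal{T}'_>$, and $${\mathcal{RB}'_{\text{glo}}}(t)=\sum_{r\in\mathcal{E}_{\mathcal{T}'}}{\mathcal{RB}_{\text{glo}}}(r)\cdot\Big({\mathcal{RB}_{\text{loc}}}(r)\,[v/{\mathcal{SB}}(r,v)\mid v\in\mathcal{PV}]\Big)\quad\text{if } t\in\mathcal{T}'_>,$$ where $b[v/{\mathcal{SB}}(r,v)\mid v\in\mathcal{PV}]$ denotes the bound obtained from $b$ by simultaneously replacing every program variable $v$ by ${\mathcal{SB}}(r,v)$. Then ${\mathcal{RB}'_{\text{glo}}}$ is also a global runtime bound for $\mathcal{P}$.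
   Context: Fix a set $\mathcal{V}$ of variables. $\mathcal{F}(\mathcal{V})$ is the set of propositional formulas built with $\land,\lor$ from atoms $p_1<p_2$ with $p_1,p_2\in\mathbb{Z}[\mathcal{V}]$. An integer program is a tuple $(\mathcal{PV},\mathcal{L},\ell_0,\mathcal{T})$ where $\mathcal{PV}\subseteq\mathcal{V}$ is a finite set of program variables (variables in $\mathcal{V}\setminus\mathcal{PV}$ are temporary variables), $\mathcal{L}$ is a finite set of locations with initial location $\ell_0\in\mathcal{L}$, and $\mathcal{T}$ is a finite set of transitions $(\ell,\varphi,\eta,\ell')$ with $\ell\in\mathcal{L}$, $\ell'\in\mathcal{L}\setminus\{\ell_0\}$, guard $\varphi\in\mathcal{F}(\mathcal{V})$ and update $\eta:\mathcal{PV}\to\mathbb{Z}[\mathcal{V}]$. Transitions with start location $\ell_0$ are initial. A state is a map $\sigma:\mathcal{V}\to\mathbb{Z}$ (applied to polynomials/formulas by substitution); $|\sigma|$ is the state with $|\sigma|(v)=|\sigma(v)|$. For $t=(\ell,\varphi,\eta,\ell')$, $(\ell,\sigma)\to_t(\ell',\sigma')$ holds iff $\sigma(\varphi)$ is true and $\sigma'(v)=\sigma(\eta(v))$ for all $v\in\mathcal{PV}$. For $\mathcal{T}''\subseteq\mathcal{T}$, $\to_{\mathcal{T}''}=\bigcup_{t\in\mathcal{T}''}\to_t$, and $\to^*$ is reflexive-transitive closure. The set of bounds $\mathcal{B}$ is the smallest set containing $\mathbb{N}\cup\{\omega\}$ and $\mathcal{PV}$ and closed under $b_1+b_2$, $b_1\cdot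 b_2$, and $k^{b_1}$ for $k\in\mathbb{N}$; bounds are evaluated in states $|\sigma|$. A global runtime bound is ${\mathcal{RB}_{\text{glo}}}:\mathcal{T}\to\mathcal{B}$ with $|\sigma_0|({\mathcal{RB}_{\text{glo}}}(t))\ge\sup\{k\in\mathbb{N}\mid\exists(\ell',\sigma').\,(\ell_0,\sigma_0)(\to^*_{\mathcal{T}}\circ\to_t)^k(\ell',\sigma')\}$ for all $t\in\mathcal{T}$ and all states $\sigma_0$. A size bound is ${\mathcal{SB}}:\mathcal{T}\times\mathcal{PV}\to\mathcal{B}$ with $|\sigma_0|({\mathcal{SB}}(t,v))\ge\sup\{|\sigma'(v)|\mid\exists\ell'.\,(\ell_0,\sigma_0)(\to^*_{\mathcal{T}}\circ\to_t)(\ell',\sigma')\}$ for all $t,v,\sigma_0$. For $\emptyset\neq\mathcal{T}'\subseteq\mathcal{T}$, the entry transitions $\mathcal{E}_{\mathcal{T}'}$ are the transitions in $\mathcal{T}\setminus\mathcal{T}'$ whose target location is the start location of some transition in $\mathcal{T}'$. For $\emptyset\neq\mathcal{T}'_>\subseteq\mathcal{T}'\subseteq\mathcal{T}$, a local runtime bound for $\mathcal{T}'_>$ w.r.t. $\mathcal{T}'$ is ${\mathcal{RB}_{\text{loc}}}:\mathcal{E}_{\mathcal{T}'}\to\mathcal{B}$ such that for all $t\in\mathcal{T}'_>$, $r\in\mathcal{E}_{\mathcal{T}'}$ and states $\sigma$: $|\sigma|({\mathcal{RB}_{\text{loc}}}(r))\ge\sup\{k\in\mathbb{N}\mid\ex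ists\sigma_0,\ell,(\ell',\sigma').\,(\ell_0,\sigma_0)\to^*_{\mathcal{T}}\circ\to_r(\ell,\sigma)(\to^*_{\mathcal{T}'}\circ\to_t)^k(\ell',\sigma')\}$.
   Formalization: The formal theorem additionally assumes that no local runtime bound RB_loc(r) contains a subterm 0^b; with 0 allowed as a base, bounds need not be weakly increasing and the claim fails (e.g. RB_loc(r) = 0^x with a size bound 5 for a variable x that r sets to 0). *)

(* Defs.v *)
From HB Require Import structures.
From Stdlib Require Import Relation_Operators.
From mathcomp Require Import all_boot all_order all_algebra finmap.
From mathcomp Require Import monalg.
From mathcomp Require Import boolp classical_sets constructive_ereal.

Set Implicit Arguments.
Unset Strict Implicit.
Unset Printing Implicit Defensive.

Import Order.TTheory GRing.Theory Num.Theory.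
Local Open Scope ring_scope.

(* Integer polynomials over an arbitrary, possibly infinite, set of variables. *)
Notation zpoly V := {malg int[{cmonom V}]}.

Definition state (V : Type) := V -> int.

Definition abs_state (V : Type) (s : state V) : state V := fun v => `|s v|.

Definition eval_poly (V : choiceType) (s : state V) (p : zpoly V) : int :=
  mmap (fun c : int => c)
       (fun m : {cmonom V} => \prod_(v <- finsupp m) s v ^+ m v) p.

Inductive formula (V : choiceType) : Type :=
| FLt of zpoly V & zpoly V
| FAnd of formula V & formula V
| FOr of formula V & formula V.

Fixpoint holds (V : choiceType) (s : state V) (phi : formula V) : bool :=
  match phi with
  | FLt p q => eval_poly s p < eval_poly s q
  | FAnd a b => holds s a && holds s b
  | FOr a b => holds s a || holds s b
  end.

Section FormulaChoice.
Variable V : choiceType.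

Fixpoint formula_encode (phi : formula V) : GenTree.tree (zpoly V) :=
  match phi with
  | FLt p q => GenTree.Node 0 [:: GenTree.Leaf p; GenTree.Leaf q]
  | FAnd a b => GenTree.Node 1 [:: formula_encode a; formula_encode b]
  | FOr a b => GenTree.Node 2 [:: formula_encode a; formula_encode b]
  end.

Fixpoint formula_decode (t : GenTree.tree (zpoly V)) : option (formula V) :=
  match t with
  | GenTree.Node 0 [:: GenTree.Leaf p; GenTree.Leaf q] => Some (FLt p q)
  | GenTree.Node 1 [:: a; b] =>
      if (formula_decode a, formula_decode b) is (Some a', Some b')
      then Some (FAnd a' b') else None
  | GenTree.Node 2 [:: a; b] =>
      if (formula_decode a, formula_decode b) is (Some a', Some b')
      then Some (FOr a' b') else None
  | _ => None
  end.

Lemma formula_encodeK : pcancel formula_encode formula_decode.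
Proof. by elim=> //= a -> b ->. Qed.

HB.instance Definition _ := Choice.copy (formula V) (pcan_type formula_encodeK).

End FormulaChoice.

Definition transition (V : choiceType) (PV : {fset V}) (L : finType) : Type :=
  (L * formula V * {ffun PV -> zpoly V} * L)%type.

HB.instance Definition _ (V : choiceType) (PV : {fset V}) (L : finType) :=
  Choice.on (transition PV L).

Section Transition.
Variables (V : choiceType) (PV : {fset V}) (L : finType).
Implicit Type t : transition PV L.

Definition source t : L := t.1.1.1.
Definition guard t : formula V := t.1.1.2.
Definition update t : {ffun PV -> zpoly V} := t.1.2.
Definition target t : L := t.2.

End Transition.

Record int_program (V : choiceType) := IntProgram {
  pvars : {fset V};
  loc : finType;
  init : loc;
  trans : {fset transition pvars loc};
  target_neq_init : forall t, t \in trans -> target t != init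
}.

Section Semantics.
Variables (V : choiceType) (P : int_program V).

Definition config : Type := (loc P * state V)%type.

(* Temporary variables, i.e. those outside [pvars P], take arbitrary values in
   the target state. *)
Definition step (t : trans P) (c c' : config) : Prop :=
  [/\ c.1 = source (val t), holds c.2 (guard (val t)), c'.1 = target (val t)
    & forall v : pvars P, c'.2 (val v) = eval_poly c.2 (update (val t) v)].

Definition step_in (S : {set trans P}) (c c' : config) : Prop :=
  exists2 t, t \in S & step t c c'.

Definition run_in (S : {set trans P}) : config -> config -> Prop :=
  clos_refl_trans config (step_in S).

(* The relation composition [run_in S] ; [step t]. *)
Definition run_then (S : {set trans P}) (t : trans P) (c c' : config) : Prop :=
  exists2 c1, run_in S c c1 & step t c1 c'.

End Semantics.

Fixpoint rel_pow (A : Type) (R : A -> A -> Prop) (k : nat) (x y : A) : Prop :=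
  if k is k'.+1 then exists2 z, R x z & rel_pow R k' z y else x = y.

Inductive bound (X : Type) : Type :=
| BNat of nat
| BOmega
| BVar of X
| BAdd of bound X & bound X
| BMul of bound X & bound X
| BExp of nat & bound X.

Arguments BNat {X} _.
Arguments BOmega {X}.

Fixpoint subst_bound (X Y : Type) (f : X -> bound Y) (b : bound X) : bound Y :=
  match b with
  | BNat n => BNat n
  | BOmega => BOmega
  | BVar v => f v
  | BAdd b1 b2 => BAdd (subst_bound f b1) (subst_bound f b2)
  | BMul b1 b2 => BMul (subst_bound f b1) (subst_bound f b2)
  | BExp k b1 => BExp k (subst_bound f b1)
  end.

(* Bounds take their values in the part N \cup {+oo} of [\bar int], +oo being
   the value of omega.  There 0 * +oo = 0, and the exponential is extended by
   0 ^ +oo = 0, 1 ^ +oo = 1 and k ^ +oo = +oo for k >= 2; also 0 ^ 0 = 1.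
   The value at -oo is junk. *)
Definition exp_ext (k : nat) (e : \bar int) : \bar int :=
  match e with
  | EFin n => EFin (Posz (k ^ `|n|%N)%N)
  | EPInf => if (k <= 1)%N then EFin (Posz k) else +oo%E
  | ENInf => 0%E
  end.

Fixpoint eval_bound (V : choiceType) (PV : {fset V}) (s : state V)
    (b : bound PV) : \bar int :=
  match b with
  | BNat n => EFin (Posz n)
  | BOmega => +oo%E
  | BVar v => EFin (s (val v))
  | BAdd b1 b2 => (eval_bound s b1 + eval_bound s b2)%E
  | BMul b1 b2 => (eval_bound s b1 * eval_bound s b2)%E
  | BExp k b1 => exp_ext k (eval_bound s b1)
  end.

(* [0 ^ b] is not weakly increasing in [b], because 0 ^ 0 = 1 and 0 ^ 1 = 0;
   every other constructor is.  Replacing a variable by an over-approximating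
   size bound is sound only for weakly increasing bounds. *)
Fixpoint no_zero_base (X : Type) (b : bound X) : bool :=
  match b with
  | BAdd b1 b2 | BMul b1 b2 => no_zero_base b1 && no_zero_base b2
  | BExp k b1 => (0 < k)%N && no_zero_base b1
  | _ => true
  end.

(* Supremum in N \cup {+oo}, with value 0 on the empty set. *)
Definition sup_nat (A : set nat) : \bar int :=
  supremum 0%E [set EFin (Posz k) | k in A]%classic.

Lemma sup_nat_leP (A : set nat) (b : \bar int) :
  (0 <= b)%E -> (sup_nat A <= b)%E <-> (forall k, A k -> (EFin (Posz k) <= b)%E).
Proof.
move=> b0; rewrite /sup_nat /supremum.
set S := ([set EFin (Posz k) | k in A])%classic.
case: ifPn => [/eqP S0|/set0P Sne].
  split=> // _ k Ak; suff : S (EFin (Posz k)) by rewrite S0.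
  by exists k.
have [l Sl] : (supremums S !=set0)%classic.
  have [[N ubN]|nub] := pselect (exists N, forall k, A k -> (k <= N)%N); last first.
    exists +oo%E; split=> [x _|x ubx]; first exact: leey.
    case: x ubx => [n||] ubx //.
      exfalso; apply: nub; exists `|n|%N => k Ak.
      have : (EFin (Posz k) <= EFin n)%E by apply: ubx; exists k.
      by rewrite lee_fin => kn; rewrite -lez_nat (le_trans kn)// lez_abs.
    case: Sne => y [k Ak _].
    by have := ubx (EFin (Posz k)) (ex_intro2 _ _ k Ak erefl).
  have exA : exists k, `[< A k >] by case: Sne => y [k Ak _]; exists k; apply/asboolP.
  have ubA k : `[< A k >] -> (k <= N)%N by move/asboolP/ubN.
  case: (ex_maxnP exA ubA) => m /asboolP Am maxm.
  exists (EFin (Posz m)); split=> [x [k Ak <-]|x ubx].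
    by rewrite lee_fin lez_nat maxm //; apply/asboolP.
  by apply: ubx; exists m.
case: xgetP => [z _ [ubz lubz]|/(_ l)//].
split=> [zb k Ak|ubb].
  by apply: le_trans zb; apply: ubz; exists k.
by apply: lubz => _ [k Ak <-]; exact: ubb.
Qed.

Section Bounds.
Variables (V : choiceType) (P : int_program V).
Local Notation T := (trans P).
Local Notation B := (bound (pvars P)).

Definition is_global_rb (RB : T -> B) : Prop :=
  forall (t : T) (s0 : state V),
    (sup_nat [set k | exists c', rel_pow (run_then finset.setT t) k (init P, s0) c']%classic
      <= eval_bound (abs_state s0) (RB t))%E.

Definition is_size_bound (SB : T -> pvars P -> B) : Prop :=
  forall (t : T) (v : pvars P) (s0 : state V),
    (sup_nat [set n | exists l' s', run_then finset.setT t (init P, s0) (l', s')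
                                    /\ n = `|s' (val v)|%N]%classic
      <= eval_bound (abs_state s0) (SB t v))%E.

Definition entry (T' : {set T}) : {set T} :=
  [set r | (r \notin T')
           && [exists t in T', target (val r) == source (val t)]]%SET.

Definition is_local_rb (Tgt T' : {set T})
    (RBloc : {r : T | r \in entry T'} -> B) : Prop :=
  forall (t : T) (r : {r : T | r \in entry T'}) (s : state V), t \in Tgt ->
    (sup_nat [set k | exists s0 l c',
                run_then finset.setT (val r) (init P, s0) (l, s)
                /\ rel_pow (run_then T' t) k (l, s) c']%classic
      <= eval_bound (abs_state s) (RBloc r))%E.

Definition improved_rb (RBglo : T -> B) (SB : T -> pvars P -> B)
    (Tgt T' : {set T}) (RBloc : {r : T | r \in entry T'} -> B) (t : T) : B :=
  if t \in Tgt then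
    \big[@BAdd _/BNat 0]_(r : {r : T | r \in entry T'})
      BMul (RBglo (val r)) (subst_bound (SB (val r)) (RBloc r))
  else RBglo t.

End Bounds.

(* Main.v *)
Require Import Defs.
From mathcomp Require Import all_boot all_order all_algebra finmap.
From Stdlib Require Import Relation_Operators.
From mathcomp Require Import constructive_ereal.

Set Implicit Arguments.
Unset Strict Implicit.
Unset Printing Implicit Defensive.

Import Order.TTheory GRing.Theory Num.Theory.

(** Flatten a run from the initial location into a sequence of transitions and
    cut it after each transition outside [T'].  A nonempty block of
    [T']-transitions is not at the start of the run, as [T'] has no initial
    transition, so it is preceded by an entry transition [r].  It contains at
    most [RBloc r] occurrences of [t], evaluated in the state reached by [r];
    replacing variables by size bounds only increases this value because
    bounds without base 0 are weakly increasing.  Finally, [r] itself occurs at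
    most [RBglo r] times. *)

Section EvalBound.
Local Open Scope ereal_scope.

Lemma exp_ext_ge0 (k : nat) (e : \bar int) : 0 <= exp_ext k e.
Proof. by case: e => [n||] //=; case: ifP. Qed.

Lemma le_exp_ext (k : nat) (a b : \bar int) :
  (0 < k)%N -> 0 <= a -> a <= b -> exp_ext k a <= exp_ext k b.
Proof.
move=> k0; case: a b => [m||] [n||] //=; rewrite ?lee_fin.
- case: m n => // m [n|//] _; rewrite !lez_nat => mn.
  by rewrite leq_pexp2l.
- move=> _ _; case: ifP => [k1|_]; last exact: leey.
  (* A positive base has a finite value at exponent [+oo] only if it is 1, and then both powers are
     1. *)
  have -> : k = 1%N by apply/eqP; rewrite eqn_leq k1.
  by rewrite exp1n.
Qed.

Variables (V : choiceType) (PV : {fset V}).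

Lemma eval_bound_ge0 (s : state V) (b : bound PV) :
  0 <= eval_bound (abs_state s) b.
Proof.
elim: b => [n||v|b1 h1 b2 h2|b1 h1 b2 h2|k b h] //=.
- exact: adde_ge0.
- exact: mule_ge0.
- exact: exp_ext_ge0.
Qed.

Lemma le_eval_subst_bound (s s0 : state V) (f : PV -> bound PV) (b : bound PV) :
  (forall v, (abs_state s (val v))%:E <= eval_bound (abs_state s0) (f v)) ->
  no_zero_base b ->
  eval_bound (abs_state s) b <= eval_bound (abs_state s0) (subst_bound f b).
Proof.
move=> sf; elim: b => [n||v|b1 h1 b2 h2|b1 h1 b2 h2|k b h] //=.
- by move=> _; exact: sf.
- by case/andP => /h1 ? /h2 ?; exact: leeD.
- by case/andP => /h1 ? /h2 ?; apply: lee_pmul => //; exact: eval_bound_ge0.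
- by case/andP => k0 /h ?; apply: le_exp_ext => //; exact: eval_bound_ge0.
Qed.

End EvalBound.

Section Runs.
Variables (V : choiceType) (P : int_program V).
Implicit Types (S : {set trans P}) (t : trans P) (c : config P).

Fixpoint run_along (c : config P) (ts : seq (trans P)) (c' : config P) : Prop :=
  if ts is t :: ts' then exists2 c1, step t c c1 & run_along c1 ts' c'
  else c = c'.

Lemma run_along_cat c ts1 ts2 c' :
  run_along c (ts1 ++ ts2) c' <->
  exists2 c1, run_along c ts1 c1 & run_along c1 ts2 c'.
Proof.
elim: ts1 c => [|t ts1 IH] c /=; first by split=> [|[_ ->]] //; exists c.
split=> [[c1 h /IH[c2 h1 h2]]|[c2 [c1 h h1] h2]].
  by exists c2 => //; exists c1.
by exists c1 => //; apply/IH; exists c2.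
Qed.

Lemma run_along_rcons c ts t c' :
  run_along c (rcons ts t) c' <-> exists2 c1, run_along c ts c1 & step t c1 c'.
Proof.
rewrite -cats1; split=> [/run_along_cat[c1 h [c2 h1 <-]]|[c1 h h1]].
  by exists c1.
by apply/run_along_cat; exists c1 => //; exists c'.
Qed.

Lemma run_inP S c c' :
  run_in S c c' <->
  exists2 ts, all (fun t => t \in S) ts & run_along c ts c'.
Proof.
split=> [|[ts]].
  elim=> {c c'} [c c' [t tS h]|c|c1 c2 c3 _ [ts1 a1 h1] _ [ts2 a2 h2]].
  - by exists [:: t]; rewrite /= ?tS //; exists c'.
  - by exists [::].
  - exists (ts1 ++ ts2); first by rewrite all_cat a1.
    by apply/run_along_cat; exists c2.
elim: ts c => [|t ts IH] c /=; first by move=> _ ->; exact: rt_refl.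
case/andP=> tS aS [c1 h h1]; apply: rt_trans (IH _ aS h1).
by apply: rt_step; exists t.
Qed.

(** Only an inequality holds: the [run_in S] segments between the [k] marked steps may themselves
    use [t]. *)
Lemma run_along_count S t k c c' :
  rel_pow (run_then S t) k c c' ->
  exists2 ts, run_along c ts c' & k <= count_mem t ts.
Proof.
elim: k c => [|k IH] c /=; first by move=> ->; exists [::].
case=> c2 [c1 /run_inP[ts1 _ h1] h2] /IH[ts2 h3 le_k].
exists (ts1 ++ t :: ts2).
  by apply/run_along_cat; exists c1 => //; exists c2.
by rewrite count_cat /= eqxx add1n addnS ltnS (leq_trans le_k) ?leq_addl.
Qed.

(** Cutting after each occurrence of [t] gives the factors. The steps after the last occurrence are
    dropped, so the final configuration may differ from [c']. *)
Lemma rel_pow_count S t c ts c' :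
  all (fun t => t \in S) ts -> run_along c ts c' ->
  exists c'', rel_pow (run_then S t) (count_mem t ts) c c''.
Proof.
elim: ts c => [|x ts IH] c /=; first by exists c.
case/andP=> xS aS [c1 h /(IH _ aS)[c'']].
have [<-|_] := eqVneq x t.
  by exists c'', c1 => //; exists c => //; exact: rt_refl.
(* If [t] still occurs, [x] joins the segment before its first occurrence; otherwise the power is 0
   and the run stays at [c]. *)
case: (count_mem t ts) => [|k] /=; first by exists c.
case=> c3 [c2 h1 h2] h3; exists c'', c3 => //; exists c2 => //.
by apply: rt_trans h1; apply: rt_step; exists x.
Qed.

Lemma all_in_setT (ts : seq (trans P)) : all (fun t => t \in [set: trans P]) ts.
Proof. by apply/allP => t _; rewrite inE. Qed.

End Runs.

Section Counting.
Local Open Scope ereal_scope.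
Variables (V : choiceType) (P : int_program V) (T' : {set trans P}).
Variables (t : trans P) (s0 : state V).
Variable M : {r : trans P | r \in entry T'} -> \bar int.
Hypothesis noninitial : forall x, x \in T' -> source (val x) != init P.
Hypothesis tT' : t \in T'.
Hypothesis M_ge0 : forall r, 0 <= M r.
Hypothesis le_M : forall (r : {r : trans P | r \in entry T'}) ts1 ts2 c c',
  run_along (init P, s0) (rcons ts1 (val r)) c ->
  all (fun x => x \in T') ts2 -> run_along c ts2 c' ->
  (Posz (count_mem t ts2))%:E <= M r.

(** Each occurrence of an entry transition [r] pays [M r] in advance for the block of
    [T']-transitions that follows it. *)
Let total (ts : seq (trans P)) : \bar int :=
  \sum_(r : {r : trans P | r \in entry T'}) (Posz (count_mem (val r) ts))%:E * M r.

Lemma total_rcons (ts : seq (trans P)) (x : trans P) :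
  total (rcons ts x) =
  total ts + \sum_(r : {r : trans P | r \in entry T'}) (Posz (x == val r))%:E * M r.
Proof.
rewrite /total -big_split /=; apply: eq_bigr => r _.
by rewrite -cats1 count_cat /= addn0 PoszD EFinD ge0_muleDl // lee_fin.
Qed.

Lemma le_total_rcons (ts : seq (trans P)) (x : trans P) :
  total ts <= total (rcons ts x).
Proof.
rewrite total_rcons leeDl //; apply: sume_ge0 => r _.
by rewrite mule_ge0 // lee_fin.
Qed.

Lemma le_total_rcons_entry (ts : seq (trans P)) (r : {r : trans P | r \in entry T'}) :
  total ts + M r <= total (rcons ts (val r)).
Proof.
rewrite total_rcons leeD2l // (bigD1 r) //= eqxx mul1e leeDl //.
by apply: sume_ge0 => r' _; rewrite mule_ge0 // lee_fin.
Qed.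

(** Here [ts2] is the trailing block of [T']-transitions, kept general so that the induction, which
    peels [ts1] from the right, can extend it to the left. *)
Lemma count_le_total_block ts1 ts2 c1 c2 :
  run_along (init P, s0) ts1 c1 -> run_along c1 ts2 c2 ->
  all (fun x => x \in T') ts2 ->
  (Posz (count_mem t ts1 + count_mem t ts2))%:E <= total ts1.
Proof.
elim/last_ind: ts1 ts2 c1 c2 => [|ts1 x IH] ts2 c1 c2.
  case: ts2 => [|y ts2] /=.
    by move=> _ _ _; rewrite sume_ge0 // => r _; rewrite mule_ge0.
  (* A nonempty block at the start of the run would begin with an initial transition of [T']. *)
  move=> <- [c [/= src _ _ _] _] /andP[/noninitial].
  by rewrite -src eqxx.
move=> hx; case/run_along_rcons: (hx) => c0 h1 hstep h2 aT.
have [xT'|xT'] := boolP (x \in T').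
  have le_tot : (Posz (count_mem t ts1 + count_mem t (x :: ts2)))%:E <= total ts1.
    by apply: (IH _ c0 c2) => //=; [exists c1 | rewrite xT'].
  apply: le_trans (le_total_rcons ts1 x); apply: le_trans le_tot.
  by rewrite -cats1 count_cat /= addn0 addnA.
have xt : (x == t) = false by apply: contraNF xT' => /eqP ->.
(* As [x] is outside [T'], the block ends here: an empty block bounds the count in [ts1] alone, and
   [ts2] must be paid for by [x]. *)
have IH0 := IH [::] _ _ h1 erefl isT; rewrite /= addn0 in IH0.
rewrite -cats1 count_cat /= xt !addn0 cats1.
case: ts2 h2 aT => [|y ts2] h2 aT.
  by rewrite addn0; exact: le_trans IH0 (le_total_rcons ts1 x).
have xE : x \in entry T'.
  rewrite inE xT'; apply/existsP; exists y.
  case/andP: aT => -> _ /=; case: h2 => c [<- _ _ _] _.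
  by case: hstep => _ _ -> _.
apply: le_trans (le_total_rcons_entry ts1 (exist _ x xE)).
by rewrite PoszD EFinD leeD //
     (@le_M (exist _ x xE) _ _ _ _ hx aT h2).
Qed.

Lemma count_le_total ts c :
  run_along (init P, s0) ts c -> (Posz (count_mem t ts))%:E <= total ts.
Proof.
by move=> h; have := @count_le_total_block ts [::] _ _ h erefl isT; rewrite /= addn0.
Qed.

End Counting.

Theorem theorem11 (V : choiceType) (P : int_program V)
  (RBglo : trans P -> bound (pvars P))
  (SB : trans P -> pvars P -> bound (pvars P))
  (Tgt T' : {set trans P})
  (RBloc : {r : trans P | r \in entry T'} -> bound (pvars P))
  (hRBglo : is_global_rb RBglo)
  (hSB : is_size_bound SB)
  (hTgt0 : Tgt != set0)
  (hTgt : Tgt \subset T')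
  (hT' : forall t, t \in T' -> source (val t) != init P)
  (hRBloc : is_local_rb Tgt RBloc)
  (hbase : forall r, no_zero_base (RBloc r)) :
  is_global_rb (improved_rb RBglo SB Tgt RBloc).
Proof.
move=> t s0; rewrite /improved_rb; case: ifPn => tTgt; last exact: hRBglo.
apply/sup_nat_leP => [|k [c' /run_along_count[ts hts le_k]]].
  exact: eval_bound_ge0.
pose M r := eval_bound (abs_state s0) (subst_bound (SB (val r)) (RBloc r)).
(* Evaluation turns the syntactic sum of bounds into a sum in [\bar int]. *)
rewrite (@big_morph _ _ (eval_bound (abs_state s0)) 0%E +%E) //=.
apply: (@le_trans _ _ (Posz (count_mem t ts))%:E%E).
  by rewrite lee_fin lez_nat.
apply: le_trans
  (@count_le_total _ P T' t s0 M hT' (subsetP hTgt _ tTgt) _ _ _ _ hts) _.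
- by move=> r; exact: eval_bound_ge0.
- move=> r ts1 ts2 [l s] c2 /run_along_rcons[c1 h1 hr] aT h2.
  have reach : run_then [set: trans P] (val r) (init P, s0) (l, s).
    by exists c1 => //; apply/run_inP; exists ts1 => //; exact: all_in_setT.
  (* The local bound applies in the state [s] reached by [r]; size bounds then carry it back to
     [s0]. *)
  apply: le_trans (_ : eval_bound (abs_state s) (RBloc r) <= _)%E.
    have [c'' hpow] := rel_pow_count t aT h2.
    have /sup_nat_leP := hRBloc t r s tTgt; apply; first exact: eval_bound_ge0.
    by exists s0, l, c''.
  apply: le_eval_subst_bound => // v.
  have /sup_nat_leP := hSB (val r) v s0.
  move=> /(_ (eval_bound_ge0 _ _) `|s (val v)|%N).
  by rewrite /abs_state abszE; apply; exists l, s.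
- apply: lee_sum => r _; apply: lee_wpmul2r; first exact: eval_bound_ge0.
  (* The whole run witnesses as many global iterations of [r] as [r] has occurrences. *)
  have [c'' hpow] := rel_pow_count (val r) (all_in_setT ts) hts.
  have /sup_nat_leP := hRBglo (val r) s0; apply; first exact: eval_bound_ge0.
  by exists c''.
Qed.
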